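(* Let $F:\mathbb{C}^n\times[0,1]\to\mathbb{C}$ be a (not necessarily continuous) subanalytic function. Suppose that for each $t\in[0,1]$, $f_t:=F(\cdot,t):\mathbb{C}^n\to\mathbb{C}$ is a (not necessarily reduced) complex homogeneous polynomial, not identically zero and with $f_t(0)=0$. If $\{f_t\}_{t\in[0,1]}$ is a topologically $\mathcal{R}$-equisingular family, then it is equimultiple, i.e. $\mathrm{ord}_0(f_t)=\mathrm{ord}_0(f_0)$ for all $t\in[0,1]$.
   Context: $\mathrm{ord}_0(f)$ is the order of vanishing of $f$ at the origin. A function is subanalytic if its graph is a subanalytic set. The family $\{f_t\}_{t\in[0,1]}$ is topologically $\mathcal{R}$-equisingular if there are an open set $U\subset\mathbb{C}^n$ (a neighborhood of $0$) and a continuous map $\varphi:U\times[0,1]\to\mathbb{C}^n$ such that, for all $t\in[0,1]$, $\varphi_t:=\varphi(\cdot,t):U\to\varphi(U\times\{t\})$ is a homeomorphism, $\varphi(0,t)=0$ and $f_t=f_0\circ\varphi_t$ (on $U$). *)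

(* Defs.v *)
From HB Require Import structures.
From mathcomp Require Import all_boot all_order all_algebra.
From mathcomp Require Import all_classical all_reals all_analysis.
From mathcomp Require Import complex.
From mathcomp Require mpoly.
(* The notations of mpoly.v are incompatible with those of MathComp-Analysis. *)
Import -(notations) mpoly.

Set Implicit Arguments.
Unset Strict Implicit.
Unset Printing Implicit Defensive.

Import Order.TTheory GRing.Theory Num.Theory numFieldNormedType.Exports.

Local Open Scope classical_set_scope.
Local Open Scope ring_scope.
Local Open Scope complex_scope.

(* The complex numbers R[i], packed as a numClosedFieldType so that they and
   their row vectors inherit the topology of the modulus.                     *)
Definition cplx (R : realType) : numClosedFieldType := R[i].

(* f is the sum, on an open cube around a, of a power series in x - a that
   converges absolutely there; [bmultinom m N] is the finite type of the
   multi-indices of degree less than N.                                       *)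
Definition analytic_at (R : realType) (m : nat) (f : 'rV[R]_m -> R)
    (a : 'rV[R]_m) : Prop :=
  exists (r : R) (c : multinom m -> R),
    [/\ 0 < r,
        summable [set: multinom m] (fun al => (c al * r ^+ mdeg al)%:E) &
        forall x : 'rV[R]_m, (forall i, `|x 0 i - a 0 i| < r) ->
          (fun N : nat => \sum_(al : bmultinom m N)
             c (bmnm al) * \prod_(i < m) (x 0 i - a 0 i) ^+ (bmnm al) i)
            @ \oo --> f x].

(* Near every point of the ambient space (not only of A), A is a finite union
   of finite intersections of sets {f = 0} and {f > 0} with f analytic.       *)
Definition semianalytic (R : realType) (m : nat) (A : set 'rV[R]_m) : Prop :=
  forall a : 'rV[R]_m, exists V : set 'rV[R]_m,
    [/\ open V, V a &
        exists (p q : nat) (f : 'I_p -> 'I_q -> 'rV[R]_m -> R)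
               (is_eq : 'I_p -> 'I_q -> bool),
          (forall i j x, V x -> analytic_at (f i j) x) /\
          A `&` V = [set x | V x /\
            exists i, forall j,
              if is_eq i j then f i j x = 0 else 0 < f i j x]].

(* Near every point of the ambient space, A is the linear projection of a
   relatively compact semianalytic set of some R^(m + k).                     *)
Definition subanalytic (R : realType) (m : nat) (A : set 'rV[R]_m) : Prop :=
  forall a : 'rV[R]_m, exists V : set 'rV[R]_m,
    [/\ open V, V a &
        exists (k : nat) (B : set 'rV[R]_(m + k)),
          [/\ semianalytic B, compact (closure B) &
              A `&` V = (fun x : 'rV[R]_(m + k) => lsubmx x) @` B]].

Definition cRe (R : realType) (w : cplx R) : R := complex.Re w.
Definition cIm (R : realType) (w : cplx R) : R := complex.Im w.

(* The identification of C^n x R x C with R^(2n + 1 + 2). *)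
Definition real_coords (R : realType) (n : nat)
    (z : 'rV[cplx R]_n) (t : R) (w : cplx R) :
    'rV[R]_(n + n + 1 + (1 + 1)) :=
  row_mx (row_mx (row_mx (\row_j cRe (z 0 j)) (\row_j cIm (z 0 j)))
                 (const_mx t))
         (row_mx (const_mx (cRe w)) (const_mx (cIm w))).

(* F stands for a function on C^n x [0, 1]: its values at the other points
   are ignored, here and in [top_R_equisingular].                             *)
Definition subanalytic_fun (R : realType) (n : nat)
    (F : 'rV[cplx R]_n * R -> cplx R) : Prop :=
  subanalytic [set x | exists (z : 'rV[cplx R]_n) (t : R),
    0 <= t <= 1 /\ x = real_coords z t (F (z, t))].

Definition homeo_onto_image (S T : topologicalType) (U : set S) (g : S -> T) :
    Prop :=
  {within U, continuous g} /\
  exists h : T -> S, {within g @` U, continuous h} /\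
    (forall x, U x -> h (g x) = x).

Definition top_R_equisingular (R : realType) (n : nat)
    (F : 'rV[cplx R]_n * R -> cplx R) : Prop :=
  exists (U : set 'rV[cplx R]_n) (phi : 'rV[cplx R]_n * R -> 'rV[cplx R]_n),
    [/\ open U, U 0,
        {within U `*` [set t : R | 0 <= t <= 1], continuous phi} &
        forall t : R, 0 <= t <= 1 ->
          [/\ homeo_onto_image U (fun z => phi (z, t)),
              phi (0, t) = 0 &
              forall z, U z -> F (z, t) = F (phi (z, t), 0)]].

(* The order of vanishing at the origin of a polynomial p: the least degree of
   a monomial of p. The default value [mmeasure (@mdeg n) p] exceeds all these
   degrees, so it is irrelevant unless p = 0 (where ord_at0 p = 0).           *)
Definition ord_at0 (n : nat) (K : nzRingType) (p : mpoly n K) : nat :=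
  \big[minn/mmeasure (@mdeg n) p]_(m <- msupp p) mdeg m.

(* Main.v *)
(* Writing d(t) for the degree of f_t, homogeneity gives
   f_t(2w) / f_t(w) = 2 ^ d(t) wherever f_t(w) <> 0. If w and 2w lie in U, both
   terms of the quotient are continuous in t because f_t = f_0 \o phi_t on U, so
   the integer 2 ^ d(t) is locally constant on the connected set [0, 1]. *)
Require Import Defs.
From HB Require Import structures.
From mathcomp Require Import all_boot all_order all_algebra.
From mathcomp Require Import all_classical all_reals all_analysis.
From mathcomp Require Import complex.
From mathcomp Require mpoly.
From mathcomp Require Import zify.
Import -(notations) mpoly.

Set Implicit Arguments.
Unset Strict Implicit.
Unset Printing Implicit Defensive.

Import Order.TTheory GRing.Theory Num.Theory numFieldNormedType.Exports.

Local Open Scope classical_set_scope.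
Local Open Scope ring_scope.

(** The fibre of [f] through [y] is both open and closed relative to [A]. The implications
    [A z -> ...] allow the interiors to be taken in [T] rather than in the subspace [A]. *)
Lemma connected_locally_constant (T : topologicalType) (S : Type) (A : set T)
    (f : T -> S) :
  connected A ->
  (forall x, A x -> \forall y \near x, A y -> f y = f x) ->
  forall x y, A x -> A y -> f x = f y.
Proof.
move=> cA fA x y Ax Ay.
suff AE : [set z | A z /\ f z = f y] = A by move: Ax; rewrite -AE => -[].
apply: cA; first by exists y.
- exists [set z | A z -> f z = f y]^°; first exact: open_interior.
  rewrite predeqE => z; split=> [[Az zy]|[Az /interior_subset]]; last first.
    by move=> /(_ Az).
  by split=> //; apply: filterS (fA _ Az) => u fu Au; rewrite fu.
- exists (~` [set z | A z -> f z <> f y]^°).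
    exact/open_closedC/open_interior.
  rewrite predeqE => z; split=> [[Az zy]|[Az nz]].
    by split=> // /interior_subset /(_ Az).
  split=> //; apply: contrapT => zy; apply: nz.
  by apply: filterS (fA _ Az) => u fu Au; rewrite fu.
Qed.

Lemma cvgX (K : numFieldType) (T : Type) (G : set_system T) (f : T -> K)
    (a : K) (k : nat) :
  Filter G -> f @ G --> a -> f x ^+ k @[x --> G] --> a ^+ k.
Proof.
move=> FG fa; elim: k => [|k IH]; first exact: cvg_cst.
by rewrite exprS; under eq_fun do rewrite exprS; exact: cvgM.
Qed.

Lemma meval_continuous (K : numFieldType) (n : nat) (p : mpoly n K) :
  continuous (fun z : 'rV[K]_n => meval (fun i => z 0 i) p).
Proof.
have cprod (m : multinom n) :
    continuous (fun z : 'rV[K]_n => \prod_i z 0 i ^+ m i).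
  apply: (@continuous_big K _ _ _ xpredT (@mul_continuous K) 'rV[K]_n _
    (fun i z => z 0 i ^+ m i)) => i _ z.
  exact: cvgX (@coord_continuous K 1 n 0 i z).
under eq_fun do rewrite mevalE.
apply: (@continuous_big K _ _ _ xpredT (@add_continuous K) 'rV[K]_n _
  (fun m z => mcoeff m p * \prod_i z 0 i ^+ m i)) => m _ z.
exact: (cvgM (cvg_cst (mcoeff m p)) (cprod m z)).
Qed.

Lemma meval_homogZ (K : fieldType) (n d : nat) (p : mpoly n K) (a : K)
    (z : 'rV[K]_n) :
  p \is ishomog1 d (@mdeg n) ->
  meval (fun i => (a *: z) 0 i) p = a ^+ d * meval (fun i => z 0 i) p.
Proof.
rewrite dhomogE => /allP pd; rewrite !mevalE mulr_sumr.
apply: eq_big_seq => m /pd /= /eqP <-.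
rewrite mulrCA mdegE -prodrXr -big_split; congr (_ * _).
by apply: eq_bigr => i _; rewrite mxE exprMn.
Qed.

Lemma ord_at0_homog (K : nzRingType) (n d : nat) (p : mpoly n K) :
  p != 0 -> p \is ishomog1 d (@mdeg n) -> ord_at0 p = d.
Proof.
rewrite -msupp_eq0 dhomogE /ord_at0 mmeasureE.
case: (msupp p) => // m s _ /= /andP[/eqP md /allP sd].
rewrite !big_cons md; apply/minn_idPl.
(* The default value of the minimum is a maximum one of whose terms is [d.+1], so it too is at least
   [d]. *)
rewrite big_seq; apply: (big_ind (leq d)) => [|k l dk dl|k /sd /eqP -> //].
  by rewrite leq_max leqnSn.
by rewrite leq_min dk dl.
Qed.

(** Both powers are images of integers, and distinct integers lie at distance at least 1. *)
Lemma expn_dist_lt1 (K : numDomainType) (c d : nat) :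
  `|2 ^+ c - 2 ^+ d : K| < 1 -> c = d.
Proof.
have -> : 2 ^+ c - 2 ^+ d = ((2 ^ c)%N%:Z - (2 ^ d)%N%:Z)%:~R :> K.
  by rewrite intrB !pmulrn -!natrX.
rewrite -intr_norm (ltr_int K _ 1) => cd.
have /eqP : (2 ^ c)%N%:Z = (2 ^ d)%N%:Z by lia.
by rewrite eqz_nat eqn_exp2l // => /eqP.
Qed.

Theorem theorem5p19 (R : realType) (n : nat)
    (F : 'rV[cplx R]_n * R -> cplx R) (P : R -> mpoly n (cplx R)) :
  subanalytic_fun F ->
  (forall t : R, 0 <= t <= 1 ->
     [/\ forall z : 'rV[cplx R]_n, F (z, t) = meval (fun i => z 0 i) (P t),
         exists d : nat, P t \is ishomog1 d (@mdeg n),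
         exists z : 'rV[cplx R]_n, F (z, t) != 0 &
         F (0, t) = 0]) ->
  top_R_equisingular F ->
  forall t : R, 0 <= t <= 1 -> ord_at0 (P t) = ord_at0 (P 0).
Proof.
move=> _ FP [U [phi [oU U0 cphi Uphi]]].
have I0 : 0 <= (0 : R) <= 1 by rewrite lexx ler01.
have homF (t : R) a z : 0 <= t <= 1 ->
    F (a *: z, t) = a ^+ ord_at0 (P t) * F (z, t).
  move=> /FP[Fm [d Pd] [y Fy0] _].
  have P0 : P t != 0 by apply: contraNneq Fy0 => P0; rewrite Fm P0 meval0.
  by rewrite !Fm (ord_at0_homog P0 Pd) (meval_homogZ _ _ Pd).
(* [F] itself need not be continuous: on [U], continuity in the parameter comes from that of [phi]
   and of the polynomial [P 0]. *)
have cF (t : R) z : 0 <= t <= 1 -> U z ->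
    F (z, s) @[s --> within [set t : R | 0 <= t <= 1] (nbhs t)] --> F (z, t).
  move=> It Uz; have [F0 _ _ _] := FP _ I0.
  have [_ _ ->//] := Uphi _ It; rewrite F0.
  have cphit : phi (z, s) @[s --> within [set t : R | 0 <= t <= 1] (nbhs t)]
      --> phi (z, t).
    move/subspace_continuousP : cphi => /(_ (z, t)) /(_ (conj Uz It)).
    apply: cvg_comp => V; rewrite !nbhs_simpl.
    move=> [[B C] /= [nBz Ct] BC].
    (* Joint continuity of [phi] is restricted to the slice with first coordinate [z]. *)
    have Bz : B z := @nbhs_singleton 'rV[cplx R]_n z B nBz.
    apply: filterS Ct => s Cs Is.
    exact: (BC (z, s) (conj Bz Cs) (conj Uz Is)).
  have := cvg_comp _ _ cphit (@meval_continuous _ _ (P 0) (phi (z, t))).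
  apply: cvg_trans; apply: near_eq_cvg; near=> s.
  have Is : 0 <= s <= 1 by near: s; exact: withinT.
  by have [_ _ ->//] := Uphi _ Is; rewrite F0.
move=> t It.
apply: (@connected_locally_constant R nat [set s | 0 <= s <= 1]
  (fun s => ord_at0 (P s)) _ _ t 0) => //.
  by rewrite -set_itvcc; exact: segment_connected.
move=> {It} {}t /= It.
have [_ _ [z Fz0] _] := FP _ It.
(* The point [z] may lie outside [U]. Take [w = a *: z] with [a] small, so that [w] and [2 *: w] lie
   in [U], and nonzero, so that homogeneity keeps the value at [w] nonzero. *)
have [w [Uw U2w Fw0]] : exists w, [/\ U w, U (2 *: w) & F (w, t) != 0].
  have cU (v : 'rV[cplx R]_n) : \forall a \near (0 : cplx R)^', U (a *: v).
    have := @scalel_continuous (cplx R) 'rV[cplx R]_n v 0.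
    rewrite /continuous_at scale0r => /(_ U) cv.
    exact/nbhs_dnbhs/cv/open_nbhs_nbhs.
  near (0 : cplx R)^' => a.
  exists (a *: z); split; first by near: a; exact: cU.
    by rewrite scalerA mulrC -scalerA; near: a; exact: cU.
  rewrite homF // mulf_neq0// expf_neq0//; near: a; exact: nbhs_dnbhs_neq.
have FD : Filter (within [set s : R | 0 <= s <= 1] (nbhs t)).
  exact: within_filter.
have Fq := cvgM (FF := FD) (cF _ _ It U2w)
  (cvgV (FF := FD) Fw0 (cF _ _ It Uw)).
(* The tolerance 1 is the one that separates distinct powers of 2. *)
have {}Fq := cvgr_dist_lt (FF := FD) _ _ Fq _ ltr01.
have Fw := cvgr_neq0 (FF := FD) _ (cF _ _ It Uw) Fw0.
(* By definition of [within], this is nearness to [t] with membership in the interval as a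
   premise. *)
suff : \forall s \near within [set s : R | 0 <= s <= 1] (nbhs t),
    ord_at0 (P s) = ord_at0 (P t) by [].
near=> s.
have Is : 0 <= s <= 1 by near: s; exact: withinT.
apply/esym/(@expn_dist_lt1 (cplx R)).
have Fsw0 : F (w, s) != 0 by near: s.
have : `|F (2 *: w, t) / F (w, t) - F (2 *: w, s) / F (w, s)| < 1 by near: s.
(* As neither denominator vanishes, the quotients are exactly the powers of 2 with exponents
   [ord_at0 (P t)] and [ord_at0 (P s)]. *)
by rewrite !homF// !mulfK.
Unshelve. all: by end_near. Qed.
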